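(* Let $A$ be a finite alphabet with at least two symbols and $X=A^{\mathbb{N}}$. There exists a sequence $\{\mu_\ell\}_{\ell\in\mathbb{N}}$ in $\mathcal{M}^+(X)$ which converges with respect to the projective distance $\rho$ but does not converge with respect to Ornstein's $\bar{d}$-distance.
   Context: For $\pmb{a}=a_1\cdots a_n\in A^n$, $[\pmb{a}]=\{\pmb{x}\in X:\ x_1\cdots x_n=\pmb{a}\}$. $\mathcal{M}^+(X)$ is the set of Borel probability measures $\mu$ on $X$ with $\mu[\pmb{a}]>0$ for all finite words $\pmb{a}$. Projective distance: $\rho(\mu,\nu)=\sup_{n\in\mathbb{N}}\max_{\pmb{a}\in A^n}\frac1n\left|\log\frac{\mu[\pmb{a}]}{\nu[\pmb{a}]}\right|$. A coupling of $\mu,\nu$ is a Borel probability measure $\lambda$ on $(A\times A)^{\mathbb{N}}$ with coordinate marginals $\mu$ and $\nu$; $J(\mu,\nu)$ is the set of couplings. With $\bar{\Delta}=\{\pmb{x}\times\pmb{y}: x_1\neq y_1\}$ and $T$ the left shift on $(A\times A)^{\mathbb{N}}$, $\bar{d}(\mu,\nu)=\inf_{\lambda\in J(\mu,\nu)}\limsup_{n\to\infty}\frac1n\sum_{k=0}^{n-1}\lambda(T^{-k}\bar{\Delta})$. *)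

(* Defs.v *)
From HB Require Import structures.
From mathcomp Require Import all_boot all_order all_algebra.
From mathcomp Require Import all_classical all_reals.
From mathcomp Require Import ereal topology normedtype sequences exp measure.
Set Implicit Arguments. Unset Strict Implicit. Unset Printing Implicit Defensive.
Import Order.TTheory GRing.Theory Num.Theory.
Local Open Scope classical_set_scope.
Local Open Scope ring_scope.

(* A finite alphabet; the point is an arbitrary (irrelevant) element, needed
   only because MathComp-Analysis measurable types are pointed. *)
HB.structure Definition FinPointed := {T of Finite T & isPointed T}.

Definition cyl (B : Type) (w : seq B) : set (nat -> B) :=
  [set x | forall i, (i < size w)%N -> x i = nth (x i) w i].

(* The generating family of cylinders; the Borel sigma-algebra of the product
   topology on B^N (B finite discrete) is the sigma-algebra it generates. *)
Definition cylinders (B : Type) : set (set (nat -> B)) :=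
  [set C | exists w : seq B, C = cyl w].

Definition seqspace (B : pointedType) : measurableType _ :=
  g_sigma_algebraType (@cylinders B).

Definition Mplus (A : FinPointed.type) (R : realType)
  (mu : probability (seqspace A) R) : Prop :=
  forall w : seq A, (0 < mu (cyl w))%E.

Definition rho (A : FinPointed.type) (R : realType)
  (mu nu : probability (seqspace A) R) : \bar R :=
  ereal_sup [set r | exists (n : nat) (a : n.+1.-tuple A),
     r = ((n.+1%:R)^-1 * `| ln (fine (mu (cyl (tval a)))
                                / fine (nu (cyl (tval a)))) |)%:E].

Definition coupling (A : FinPointed.type) (R : realType)
  (mu nu : probability (seqspace A) R)
  (lam : probability (seqspace (A * A)%type) R) : Prop :=
  (forall B : set (seqspace A), measurable B ->
     lam ((fun z : nat -> A * A => (fun n => (z n).1)) @^-1` B) = mu B) /\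
  (forall B : set (seqspace A), measurable B ->
     lam ((fun z : nat -> A * A => (fun n => (z n).2)) @^-1` B) = nu B).

Definition diag_off_at (A : FinPointed.type) (k : nat) : set (nat -> A * A) :=
  [set z | (z k).1 <> (z k).2].

Definition dbar (A : FinPointed.type) (R : realType)
  (mu nu : probability (seqspace A) R) : \bar R :=
  ereal_inf [set limn_esup (fun n : nat =>
                   ((n%:R)^-1)%:E * \sum_(0 <= k < n) lam (@diag_off_at A k))%E
            | lam in coupling mu nu].

(* Main.v *)
(* Let phi_j replace every coordinate of index at least (j+1)^2 by the constant
   symbol c (phi_0 being the identity), let m0 be a fully supported atomic
   measure whose atoms end in d <> c, and put m = sum_j 2^-(j+1) (phi_j)_* m0.
   Since phi_j o phi_i is always phi_i or phi_j, (phi_j)_* m is at most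
   (1 + 2^(j+1)) m; it moreover agrees with m on words of length at most
   (j+1)^2.  Hence mu_j = (m + (phi_j)_* m) / 2 is within O(j) / (j+1)^2 of m
   for rho.  On the other hand mu_j(x_k <> c) is half of m(x_k <> c) for all
   large k, and m(x_k <> c) is bounded below.  A coupling has to pay for this
   difference at every large time, so no measure is dbar-close both to m and
   to mu_j, and a sequence alternating between m and mu_j does not converge. *)

Require Import Defs.
From HB Require Import structures.
From mathcomp Require Import all_boot all_order all_algebra.
From mathcomp Require Import all_classical all_reals.
From mathcomp Require Import ereal topology normedtype sequences exp measure random_variable.
From mathcomp Require Import lra.
Set Implicit Arguments. Unset Strict Implicit. Unset Printing Implicit Defensive.
Import Order.TTheory GRing.Theory Num.Theory.
Local Open Scope classical_set_scope.
Local Open Scope ring_scope.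

(** * Mixtures of probabilities with weights [2^-(i+1)] *)

Section geometric_mixture.
Context d (T : measurableType d) (R : realType).
Implicit Type nu : nat -> probability T R.

Let weight i : R := (2 ^+ i.+1)^-1.
Let weight_ge0 i : 0 <= weight i.
Proof. by rewrite invr_ge0 exprn_ge0. Qed.

Let sum_weight : (\sum_(i <oo) (weight i)%:E = 1)%E.
Proof.
rewrite (_ : (fun _ => _) = eseries (fun k => (1 / (2 ^ (k + 1))%:R)%:E)).
  apply/cvg_lim => //.
  by have := @cvg_geometric_eseries_half R 1 0; rewrite expr0 divr1.
by apply/funext => n; apply: eq_bigr => i _; rewrite addn1 natrX div1r.
Qed.

Local Notation mix nu :=
  (mseries (fun i => mscale (NngNum (weight_ge0 i)) (nu i)) 0).

Let mix_setT nu : mix nu setT = 1%E.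
Proof.
rewrite -sum_weight; apply: eq_eseriesr => i _.
transitivity ((weight i)%:E * nu i setT)%E; first by []. by rewrite probability_setT mule1.
Qed.

Definition mixture nu : probability T R :=
  HB.pack (mix nu) (Measure_isProbability.Build _ _ _ (mix nu) (mix_setT nu)).

Lemma mixtureE nu B :
  (mixture nu B = \sum_(i <oo) ((2 ^+ i.+1)^-1)%:E * nu i B)%E.
Proof. by []. Qed.

Lemma le_mixture nu i B : (((2 ^+ i.+1)^-1)%:E * nu i B <= mixture nu B)%E.
Proof.
rewrite mixtureE (@nneseriesD1 _ _ i)//; last first.
  by move=> k _; rewrite mule_ge0// lee_fin.
by rewrite leeDl// nneseries_ge0// => k _ _; rewrite mule_ge0// lee_fin.
Qed.

(** The weights sum to 1, so an additive error uniform in [i] survives unchanged in the mixture. *)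
Lemma mixture_leD nu nu' B B' (r : R) : 0 <= r ->
  (forall i, nu i B <= nu' i B' + r%:E)%E -> (mixture nu B <= mixture nu' B' + r%:E)%E.
Proof.
move=> r0 nur; rewrite !mixtureE -[X in (_ + X)%E]mule1 -sum_weight.
rewrite -nneseriesZl => [|i _]; last by rewrite lee_fin.
rewrite -nneseriesD => [|i _ _|i _ _].
- apply: lee_nneseries => i _; first by move=> _; rewrite mule_ge0// lee_fin.
  by rewrite [X in (_ + X)%E]muleC -ge0_muleDr ?lee_fin// lee_wpmul2l// lee_fin.
- by rewrite mule_ge0// lee_fin.
- by rewrite mule_ge0// lee_fin.
Qed.

Lemma mixture_le nu B (r : R) :
  (forall i, nu i B <= r%:E)%E -> (mixture nu B <= r%:E)%E.
Proof.
move=> nur; rewrite -[leRHS]add0e -(measure0 (mixture nu)).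
have r0 : 0 <= r by rewrite -lee_fin (le_trans _ (nur 0)).
by apply: mixture_leD => // i; rewrite measure0 add0e.
Qed.

Lemma mixture_cst nu B : measurable B -> (forall i, nu i B = nu 0 B) ->
  mixture nu B = nu 0 B.
Proof.
move=> mB nuB; rewrite mixtureE -(fineK (fin_num_measure (nu 0) _ mB)).
rewrite -[RHS]mule1 -sum_weight -nneseriesZl => [|i _]; last by rewrite lee_fin.
by apply: eq_eseriesr => i _; rewrite nuB muleC fineK// fin_num_measure.
Qed.

End geometric_mixture.

(** * Measurability of cylinders and of single-coordinate events *)

Section cylinders.
Context (B : pointedType).

Lemma measurable_cyl (w : seq B) : measurable (cyl w : set (seqspace B)).
Proof. by apply: sub_sigma_algebra; exists w. Qed.

Lemma cyl_rcons (w : seq B) b : cyl (rcons w b) = cyl w `&` [set x | x (size w) = b].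
Proof.
apply/seteqP; split=> x /=; rewrite /cyl/= size_rcons.
  move=> xwb; split=> [i iw|]; last by rewrite xwb// nth_rcons ltnn eqxx.
  by rewrite {1}(xwb i (ltnW iw)) nth_rcons iw.
move=> [xw xb] i; rewrite ltnS leq_eqVlt => /predU1P[->|iw].
  by rewrite nth_rcons ltnn eqxx.
by rewrite nth_rcons iw; exact: xw.
Qed.

Lemma measurable_coord (P : set B) (k : nat) : finite_set [set: B] ->
  measurable ([set x | P (x k)] : set (seqspace B)).
Proof.
move=> finB; rewrite (_ : mkset _ = cyl [::] `&` [set x | P (x (size ([::] : seq B) + k)%N)]).
  elim: k [::] => [|k IHk] w.
    rewrite (_ : _ `&` _ = \bigcup_(b in P) cyl (rcons w b)).
      apply: fin_bigcup_measurable => [|b _]; last exact: measurable_cyl.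
      exact: sub_finite_set finB.
    apply/seteqP; split=> x /=; rewrite addn0.
      by move=> [xw Px]; exists (x (size w)); rewrite ?cyl_rcons.
    by move=> [b Pb]; rewrite cyl_rcons => -[xw /= ->].
  rewrite (_ : _ `&` _ = \bigcup_(b in setT) (cyl (rcons w b) `&`
      [set x | P (x (size (rcons w b) + k)%N)])).
    by apply: fin_bigcup_measurable => // b _; exact: IHk.
  apply/seteqP; split=> x /=.
    by move=> [xw Px]; exists (x (size w)); rewrite ?cyl_rcons//= size_rcons addSnnS.
  by move=> [b _]; rewrite cyl_rcons/= size_rcons addSnnS => -[[]].
by apply/seteqP; split=> x //= -[].
Qed.

End cylinders.

(** * Truncation maps with tail [c] *)

Section cut.
Context (A : FinPointed.type) (c : A).

(* The cut length is quadratic in [j] so that the factor [2 ^ j] lost by a mixture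
   with weights [2 ^- j.+1] is subexponential in it; [j = 0] does not cut. *)
Definition cut (j : nat) (x : seqspace A) : seqspace A :=
  fun i => if (j == 0) || (i < j.+1 ^ 2)%N then x i else c.

(** The shorter of the two cuts wins: each cut fixes every sequence that already equals [c] beyond
    its length. *)
Lemma cut_cut i j x : cut j (cut i x) = cut i x \/ cut j (cut i x) = cut j x.
Proof.
have [-> |j0] := eqVneq j 0%N; first by left.
have [-> |i0] := eqVneq i 0%N; first by right.
case: (leqP i j) => ij; [left|right]; apply/funext => k; rewrite /cut.
  rewrite (negbTE i0) (negbTE j0) /=; case: (ltnP k (j.+1 ^ 2)) => // jk.
  by rewrite ltnNge (leq_trans _ jk)// leq_exp2r.
rewrite (negbTE i0) (negbTE j0) /=; case: (ltnP k (j.+1 ^ 2)) => // jk.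
by rewrite (leq_trans jk)// leq_exp2r// ltnW.
Qed.

Lemma cut_cyl j (w : seq A) : (j == 0) || (size w <= j.+1 ^ 2)%N ->
  cut j @^-1` cyl w = cyl w.
Proof.
move=> jw; suff cutE x i : (i < size w)%N -> cut j x i = x i.
  by apply/seteqP; split=> x xw i iw; move: (xw i iw); rewrite cutE.
move=> iw; rewrite /cut; case/orP: jw => [-> //|jw].
by rewrite (leq_trans iw jw) orbT.
Qed.

Lemma measurable_cut j : measurable_fun setT (cut j).
Proof.
apply: (@measurability _ _ (seqspace A) (seqspace A) setT (cut j) (@cylinders A)); first by [].
move=> _ [_ [w ->] <-]; rewrite setTI.
case: (boolP ((j == 0) || (size w <= j.+1 ^ 2)%N)) => [jw|].
  by rewrite (cut_cyl jw); exact: measurable_cyl.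
rewrite negb_or -ltnNge => /andP[/negbTE j0 jw].
have cutE x i : cut j x i = if (i < j.+1 ^ 2)%N then x i else c by rewrite /cut j0.
(* The word [w] outlasts the cut. Its preimage is the cylinder of the truncated word if all later
   letters are [c], and empty otherwise. *)
have [wc|wc] := pselect (forall i, (j.+1 ^ 2 <= i < size w)%N -> nth c w i = c).
  rewrite (_ : _ @^-1` _ = cyl (take (j.+1 ^ 2) w)); first exact: measurable_cyl.
  apply/seteqP; split=> x /=; rewrite /cyl/= size_take jw => xw i iw.
    by rewrite nth_take//; have := xw i (ltn_trans iw jw); rewrite cutE iw.
  rewrite cutE; case: ifPn => ij; first by have := xw i ij; rewrite nth_take.
  by rewrite wc// iw leqNgt ij.
rewrite (_ : _ @^-1` _ = set0)//; apply/seteqP; split=> x //= xw; apply: wc.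
move=> i /andP[ji iw]; have := xw i iw; by rewrite cutE ltnNge ji /= => <-.
Qed.

HB.instance Definition _ j := isMeasurableFun.Build _ _ _ _ (cut j) (measurable_cut j).

End cut.

(** * The limit measure and its perturbations *)

Section perturbation.
Context (R : realType) (A : FinPointed.type) (c d : A).

(** Enumerates the finite words continued by [d] forever; a number that codes no word yields the
    constant sequence [d]. *)
Let atom (n : nat) : seqspace A :=
  nth d (odflt [::] (@unpickle (seq A) n)).

Definition base : probability (seqspace A) R :=
  mixture (fun n => \d_(atom n)).

Definition recut : probability (seqspace A) R :=
  mixture (fun j => distribution base (cut c j)).

(** All components with [i > 0] coincide and have total weight 1/2, so this is the half-half average
    of [recut] and its image under [cut c j]. *)
Definition perturb (j : nat) : probability (seqspace A) R :=
  mixture (fun i => if i is 0 then recut else distribution recut (cut c j)).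

Lemma base_cyl_gt0 (w : seq A) : (0 < base (cyl w))%E.
Proof.
apply: lt_le_trans (le_mixture _ (pickle w) _).
rewrite [X in (_ * X)%E](_ : _ = 1%E) ?mule1 ?lte_fin ?invr_gt0 ?exprn_gt0//.
rewrite [LHS]diracE mem_set// => i iw; rewrite /atom pickleK /=.
exact: set_nth_default.
Qed.

Lemma recut_ge j B :
  (((2 ^+ j.+1)^-1)%:E * base (cut c j @^-1` B) <= recut B)%E.
Proof. exact: le_mixture. Qed.

Lemma recut_cyl_gt0 (w : seq A) : (0 < recut (cyl w))%E.
Proof.
apply: lt_le_trans (recut_ge 0 _); rewrite cut_cyl//.
by rewrite mule_gt0 ?base_cyl_gt0// lte_fin invr_gt0 exprn_gt0.
Qed.

(** The bound is the weight of the uncut component [j = 0] times that of the atom coded by the empty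
    word, which is constantly [d]. *)
Lemma recut_neq : d <> c -> exists2 e : R, 0 < e &
  forall k, (e%:E <= recut [set x | x k <> c])%E.
Proof.
move=> dc; exists (2^-1 * (2 ^+ (@pickle (seq A) [::]).+1)^-1).
  by rewrite mulr_gt0// invr_gt0 ?exprn_gt0.
move=> k; apply: le_trans (recut_ge 0 _); rewrite EFinM lee_wpmul2l ?lee_fin ?invr_ge0//.
apply: le_trans (le_mixture _ (@pickle (seq A) [::]) _).
rewrite [X in (_ * X)%E](_ : _ = 1%E) ?mule1//.
by rewrite [LHS]diracE mem_set//= /atom pickleK /=; case: k.
Qed.

Lemma recut_cut_le j B : measurable B ->
  (recut (cut c j @^-1` B) <= (1 + 2 ^+ j.+1)%:E * recut B)%E.
Proof.
move=> mB.
have mcut i C : measurable C -> measurable (cut c i @^-1` C).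
  by move=> mC; rewrite -[X in measurable X]setTI; exact: measurable_cut.
have mbase := fin_num_measure base _ (mcut j _ mB).
apply: (@le_trans _ _ (recut B + (fine (base (cut c j @^-1` B)))%:E)).
  apply: mixture_leD => [|i]; first exact: fine_ge0.
  rewrite fineK//; apply: le_trans (measureU2 base (mcut i _ mB) (mcut j _ mB)).
  apply: (@le_measure _ _ _ base); rewrite ?inE.
  - exact: (mcut _ _ (mcut _ _ mB)).
  - exact: measurableU (mcut _ _ mB) (mcut _ _ mB).
  - by move=> x /=; case: (cut_cut c i j x) => ->; [left|right].
rewrite fineK// EFinD ge0_muleDl ?lee_fin ?exprn_ge0// mul1e leeD2l//.
have /(lee_wpmul2l (x := (2 ^+ j.+1)%:E)) := recut_ge j B.
rewrite muleA -EFinM mulfV ?expf_neq0// mul1e; apply.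
by rewrite lee_fin exprn_ge0.
Qed.

Lemma perturb_ge j B : ((2^-1)%:E * recut B <= perturb j B)%E.
Proof. by rewrite -[X in X^-1]expr1; exact: (le_mixture _ 0). Qed.

Lemma perturb_le j B : measurable B ->
  (perturb j B <= (1 + 2 ^+ j.+1)%:E * recut B)%E.
Proof.
move=> mB; rewrite -(fineK (fin_num_measure recut _ mB)).
apply: mixture_le => -[|i]; last by rewrite EFinM fineK ?fin_num_measure//; exact: recut_cut_le.
by rewrite EFinM fineK ?fin_num_measure// -[leLHS]mul1e lee_wpmul2r// lee_fin lerDl exprn_ge0.
Qed.

Lemma perturb_cyl j (w : seq A) : (j == 0) || (size w <= j.+1 ^ 2)%N ->
  perturb j (cyl w) = recut (cyl w).
Proof.
move=> jw; apply: mixture_cst => [|[|i]//]; first exact: measurable_cyl.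
by rewrite [LHS](_ : _ = recut (cut c j @^-1` cyl w))// cut_cyl.
Qed.

Lemma perturb_cyl_gt0 j (w : seq A) : (0 < perturb j (cyl w))%E.
Proof.
apply: lt_le_trans (perturb_ge _ _).
by rewrite mule_gt0 ?recut_cyl_gt0.
Qed.

Lemma perturb0 B : measurable B -> perturb 0 B = recut B.
Proof. by move=> mB; apply: mixture_cst => // -[|i]. Qed.

(** Beyond the cut, the image under [cut c j] only shows [c], so only the [i = 0] term
    contributes. *)
Lemma perturb_neq j k : j != 0 -> (j.+1 ^ 2 <= k)%N ->
  perturb j [set x | x k <> c] = ((2^-1)%:E * recut [set x | x k <> c])%E.
Proof.
move=> j0 jk; rewrite /perturb mixtureE (@nneseriesD1 _ _ 0)// ?expr1; last first.
  by move=> i _; rewrite mule_ge0// lee_fin.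
rewrite eseries0 ?adde0// => -[//|i] _ _.
rewrite [X in (_ * X)%E](_ : _ = recut (cut c j @^-1` [set x | x k <> c]))//.
rewrite (_ : _ @^-1` _ = set0) ?measure0 ?mule0//.
by apply/seteqP; split => x //=; rewrite /cut (negbTE j0) ltnNge jk.
Qed.

End perturbation.

(** * Upper bounds for the projective distance *)

Section projective_distance.
Context (R : realType) (A : FinPointed.type).
Implicit Types mu nu : probability (seqspace A) R.

Lemma rho_ge0 mu nu : (0 <= rho mu nu)%E.
Proof.
apply: le_ereal_sup_tmp; eexists; first by exists 0, (nseq_tuple 1 (point : A)).
by rewrite lee_fin mulr_ge0// invr_ge0.
Qed.

Lemma rho_le mu nu (eps : R) : Mplus mu -> Mplus nu ->
  (forall w : seq A, exists K : R, [/\ 0 < K,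
     (mu (cyl w) <= K%:E * nu (cyl w))%E, (nu (cyl w) <= K%:E * mu (cyl w))%E &
     ln K <= (size w)%:R * eps]) ->
  (rho mu nu <= eps%:E)%E.
Proof.
move=> muP nuP munu; apply: ge_ereal_sup => _ [n [a ->]].
have [K [K0 muK nuK lnK]] := munu a; rewrite size_tuple in lnK.
rewrite lee_fin mulrC ler_pdivrMr// [leRHS]mulrC.
have mu0 := muP a; have nu0 := nuP a.
have mufin := fin_num_measure mu _ (measurable_cyl a).
have nufin := fin_num_measure nu _ (measurable_cyl a).
move: mu0 nu0 muK nuK; rewrite -(fineK mufin) -(fineK nufin) -!EFinM !lee_fin !lte_fin /=.
set p := fine _; set q := fine _ => p0 q0 pq qp.
apply: le_trans lnK; rewrite ler_norml -lnV ?posrE// !ler_ln ?posrE ?divr_gt0 ?invr_gt0//.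
by rewrite ler_pdivlMr// ler_pdivrMr// pq andbT mulrC ler_pdivrMr// mulrC.
Qed.

(** Short words have equal mass under both measures; on long ones the factor [1 + 2^(j+1)] is
    compared with a length above [(j+1)^2]. The index [l] gives one bound for cut and uncut
    terms. *)
Lemma rho_perturb (c d : A) (j l : nat) : (j == 0) || (j == l) ->
  (rho (perturb R c d j) (recut R c d) <= (2 * l.+1%:R^-1)%:E)%E.
Proof.
move=> jl; apply: rho_le => [||w]; [exact: perturb_cyl_gt0|exact: recut_cyl_gt0|].
have [jw|] := boolP ((j == 0) || (size w <= j.+1 ^ 2)%N).
  by exists 1; rewrite ln1 !mul1e perturb_cyl.
rewrite negb_or -ltnNge => /andP[j0 jw].
have {jl} -> : l = j by move: jl; rewrite (negbTE j0) => /eqP.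
exists (1 + 2 ^+ j.+1); split.
- by rewrite addr_gt0// exprn_gt0.
- by apply: perturb_le; exact: measurable_cyl.
- have /(lee_wpmul2l (x := 2%:E)) := perturb_ge R c d j (cyl w).
  rewrite muleA -EFinM mulfV// mul1e lee_fin ler0n => /(_ isT)/le_trans; apply.
  rewrite lee_wpmul2r// lee_fin -[leLHS]/(1 + 1).
  by rewrite lerD2l exprn_ege1 ?ler1n.
(* Since [ln 2 <= 1], the logarithm is at most [j+2 <= 2(j+1)], hence at most [2/(j+1)] times the
   length. *)
apply: (@le_trans _ _ (ln (2 ^+ j.+2))).
  rewrite ler_ln ?posrE ?addr_gt0 ?exprn_gt0// [leRHS]exprS mulr_natl [leRHS]mulr2n.
  by rewrite lerD2r exprn_ege1 ?ler1n.
rewrite lnXn//; apply: (@le_trans _ _ (j.+2%:R)).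
  by rewrite lerMn2r /= (@le_ln1Dx _ 1)// (lt_trans (ltrN10 _)).
rewrite mulrA ler_pdivlMr// -!natrM ler_nat.
apply: (@leq_trans (j.+1 ^ 2 * 2)); last by rewrite leq_mul// ltnW.
by rewrite expnS expn1 -mulnA [leqLHS]mulnC leq_mul2l /= muln2 -addnn addnS ltnS leq_addr.
Qed.

End projective_distance.

(** * Lower bounds for the dbar distance *)

Section dbar_lower_bound.
Context (R : realType) (A : FinPointed.type).
Implicit Types mu nu : probability (seqspace A) R.

Lemma measurable_diag_off k :
  measurable (@diag_off_at A k : set (seqspace (A * A)%type)).
Proof.
exact: (@measurable_coord (A * A)%type [set p | p.1 <> p.2] k finite_finset).
Qed.

(** Where the two coordinates agree at time [k], the event [P] holds for both or for neither. *)
Lemma coupling_le mu nu lam (P : set A) k : coupling mu nu lam ->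
  (mu [set x | P (x k)] <= nu [set x | P (x k)] + lam (@diag_off_at A k))%E /\
  (nu [set x | P (x k)] <= mu [set x | P (x k)] + lam (@diag_off_at A k))%E.
Proof.
move=> [lam1 lam2].
have mP : measurable ([set x | P (x k)] : set (seqspace A)).
  exact: measurable_coord finite_finset.
have m1 : measurable ([set z | P (z k).1] : set (seqspace (A * A)%type)).
  exact: (@measurable_coord (A * A)%type [set p | P p.1] k finite_finset).
have m2 : measurable ([set z | P (z k).2] : set (seqspace (A * A)%type)).
  exact: (@measurable_coord (A * A)%type [set p | P p.2] k finite_finset).
have mD := measurable_diag_off k.
rewrite -lam1// -lam2//; split.
  apply: le_trans (measureU2 lam m2 mD).
  apply: (@le_measure _ _ _ lam); rewrite ?inE//; first exact: measurableU.
  move=> z Pz /=; have [zk|] := eqVneq (z k).1 (z k).2; last by move/eqP; right.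
  by left; rewrite /= -zk.
apply: le_trans (measureU2 lam m1 mD).
apply: (@le_measure _ _ _ lam); rewrite ?inE//; first exact: measurableU.
move=> z Pz /=; have [zk|] := eqVneq (z k).1 (z k).2; last by move/eqP; right.
by left; rewrite /= zk.
Qed.

Lemma dbar_lt mu nu (e : R) : (dbar mu nu < e%:E)%E ->
  exists2 lam, coupling mu nu lam & exists N, forall n, (N <= n)%N ->
    ((n%:R^-1)%:E * \sum_(0 <= k < n) lam (@diag_off_at A k) < e%:E)%E.
Proof.
move=> /ereal_inf_lt[_ [lam lamP <-]] /ereal_inf_lt[_ [V [N _ NV] <-] Ve].
exists lam => //; exists N => n Nn; apply: le_lt_trans Ve.
by apply: ereal_sup_ubound; exists n => //; exact: NV.
Qed.

Lemma dbar_separation mu mu' nu (P : set A) (e : R) N :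
  (forall k, (N <= k)%N ->
    (mu' [set x | P (x k)] + e%:E <= mu [set x | P (x k)])%E) -> 0 < e ->
  (dbar mu nu < (e / 4)%:E)%E -> (dbar mu' nu < (e / 4)%:E)%E -> False.
Proof.
move=> gap e0 /dbar_lt[lam lamP [n1 dn1]] /dbar_lt[lam' lamP' [n2 dn2]].
pose D k := fine (lam (@diag_off_at A k)).
pose D' k := fine (lam' (@diag_off_at A k)).
have DE k : lam (@diag_off_at A k) = (D k)%:E.
  by rewrite fineK// (fin_num_measure lam)//; exact: measurable_diag_off.
have DE' k : lam' (@diag_off_at A k) = (D' k)%:E.
  by rewrite fineK// (fin_num_measure lam')//; exact: measurable_diag_off.
have D0 k : 0 <= D k + D' k by rewrite addr_ge0// fine_ge0.
(* Triangle inequality through [nu]: pass from [mu] to [nu] by [lam], then from [nu] to [mu'] by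
   [lam']. *)
have De k : (N <= k)%N -> e <= D k + D' k.
  move=> /gap; have [+ _] := coupling_le P k lamP; have [_] := coupling_le P k lamP'.
  have mP : measurable ([set x | P (x k)] : set (seqspace A)).
    exact: measurable_coord finite_finset.
  rewrite -(fineK (fin_num_measure mu _ mP)) -(fineK (fin_num_measure mu' _ mP)).
  rewrite -(fineK (fin_num_measure nu _ mP)) DE DE' -!EFinD !lee_fin; lra.
have sumD n : (n - N)%:R * e <= \sum_(0 <= k < n) (D k + D' k).
  elim: n => [|n IHn]; first by rewrite mul0r big_nil.
  rewrite big_nat_recr//=; have [Nn|nN] := leqP N n.
    by rewrite subSn// -natr1 mulrDl mul1r lerD// De.
  have -> : (n.+1 - N = 0)%N by apply/eqP; rewrite subn_eq0.
  by rewrite mul0r; apply: addr_ge0 => //; exact: sumr_ge0.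
(* Past both thresholds, and at least [2N], so that at least half of the times carry the cost [e];
   the two averages would then sum to at least [e/2]. *)
pose n := (maxn n1 n2 + N.*2).+1.
have avg (E : nat -> R) :
    ((n%:R^-1)%:E * \sum_(0 <= k < n) (E k)%:E < (e / 4)%:E)%E ->
    \sum_(0 <= k < n) E k < n%:R * (e / 4).
  by rewrite sumEFin -EFinM lte_fin ltr_pdivrMl.
have n1n : (n1 <= n)%N by rewrite /n leqW// -[leqLHS]addn0 leq_add// leq_maxl.
have n2n : (n2 <= n)%N by rewrite /n leqW// -[leqLHS]addn0 leq_add// leq_maxr.
have Nn : n%:R * e <= 2 * ((n - N)%:R * e).
  have Nn : (2 * N <= n)%N by rewrite /n mul2n leqW// leq_addl.
  rewrite mulrA ler_pM2r// -natrM ler_nat mulnBr leq_subRL.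
    by rewrite [leqRHS]mul2n -addnn leq_add2r.
  by rewrite (leq_trans Nn)// mul2n -addnn leq_addr.
move: (dn1 n n1n) (dn2 n n2n) (sumD n).
under eq_bigr do rewrite DE; under [in X in _ -> X -> _]eq_bigr do rewrite DE'.
move=> /avg + /avg; rewrite big_split/=; lra.
Qed.

End dbar_lower_bound.

Theorem theorem3p2 (R : realType) (A : FinPointed.type) (hA : (1 < #|A|)%N) :
  exists mu : nat -> probability (seqspace A) R,
    (forall l, Mplus (mu l)) /\
    (exists m : probability (seqspace A) R,
        Mplus m /\ (rho (mu l) m @[l --> \oo] --> 0%E)) /\
    ~ (exists m : probability (seqspace A) R,
        Mplus m /\ (dbar (mu l) m @[l --> \oo] --> 0%E)).
Proof.
have [c [d [_ _ cd]]] := card_gt1P hA.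
have dc : d <> c by apply/eqP; rewrite eq_sym.
(* Even terms are [recut] on measurable sets, since [j = 0] does not cut; odd terms are cut. *)
exists (fun l => perturb R c d (if odd l then l else 0%N)); split.
  by move=> l w; exact: perturb_cyl_gt0.
split.
  exists (recut R c d); split; first by move=> w; exact: recut_cyl_gt0.
  apply: (@squeeze_cvge _ _ _ _ (cst 0%E) _ (fun l => (2 * l.+1%:R^-1)%:E)).
  - apply: nearW => l; rewrite rho_ge0 rho_perturb//.
    by case: (odd l); rewrite eqxx ?orbT.
  - exact: cvg_cst.
  - rewrite -[X in _ --> X](mule0 2%:E); under eq_fun do rewrite EFinM.
    by apply: cvgeZl => //; exact: cvge_harmonic.
move=> [m [_ cvm]].
have [e e0 recut_e] := recut_neq R dc.
(* Halving a mass of at least [e] leaves a gap of at least [e / 2]; the separation lemma asks for a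
   quarter of the gap. *)
have e80 : (0 < (e / 2 / 4)%:E)%E by rewrite lte_fin !divr_gt0.
have [N _ Nm] := cvm _ (open_ereal_lt' e80).
have NN : (N <= N.*2)%N by rewrite -addnn leq_addr.
(* The consecutive indices [2N] and [2N+1] give one uncut and one cut term, both close to [m]. *)
have := Nm _ NN; rewrite /= odd_double => dm0.
have := Nm _ (leqW NN); rewrite /= odd_double => dm.
apply: (dbar_separation (P := [set a | a <> c]) (N := (N.*2.+2 ^ 2)%N) _ _ dm0 dm); last exact: divr_gt0.
move=> k Nk; rewrite (@perturb_neq R A c d N.*2.+1 k)//.
have mk : measurable ([set x | x k <> c] : set (seqspace A)).
  exact: (@measurable_coord A [set a | a <> c] k finite_finset).
rewrite perturb0//; have := recut_e k.
by rewrite -(fineK (fin_num_measure (recut R c d) _ mk)) -EFinM -EFinD !lee_fin; lra.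
Qed.
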